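(* For each integer $i\geq 1$ let $k_i=2\log_2|i|_2+1$, where $|i|_2$ denotes the largest power of $2$ dividing $i$ (so $\log_2|i|_2$ is the largest $\nu\in\mathbb{Z}$ satisfying $2^\nu\mid i$). Write the infinite Calkin-Wilf sequence as $$\mathcal{CW}_\infty=\left[\frac{a_0}{a_1},\frac{a_1}{a_2},\dots,\frac{a_{i-1}}{a_i},\dots\right],$$ and, for an integer $n\geq 1$ and $N=2^{n-1}$, write the $n$-th Calkin-Wilf sequence (which has $N$ terms) as $$\mathcal{CW}_n=\left[\frac{b_{-1}}{b_0},\frac{b_0}{b_1},\frac{b_1}{b_2},\dots,\frac{b_{N-2}}{b_{N-1}}\right].$$ Then the $a_i$ and $b_i$ are given by the recurrence relations $$a_{-1}=0,\quad a_0=1,\quad a_i=k_ia_{i-1}-a_{i-2}\quad\text{for } 1\leq i<\infty,$$ (where $a_{-1}:=0$ is an auxiliary initial value), and $$b_{-1}=1,\quad b_0=n,\quad b_i=k_ib_{i-1}-b_{i-2}\quad\text{for } 1\leq i<N.$$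
   Context: Fractions are regarded as pairs (numerator, denominator) of positive integers. The Calkin-Wilf sequences $\mathcal{CW}_n$ ($n\geq 1$) are finite sequences of fractions defined recursively: $\mathcal{CW}_1=\left[\frac11\right]$, and for $n\geq 2$ the sequence $\mathcal{CW}_n$ is obtained from $\mathcal{CW}_{n-1}$ by replacing each fraction $\frac pq$, in order from left to right, by the two fractions $\frac{p}{p+q},\frac{p+q}{q}$ (in this order). For example $\mathcal{CW}_2=\left[\frac12,\frac21\right]$ and $\mathcal{CW}_3=\left[\frac13,\frac32,\frac23,\frac31\right]$. One has $|\mathcal{CW}_n|=2^{n-1}$. The sequence $\mathcal{CW}_\infty$ is the concatenation of $\mathcal{CW}_1,\mathcal{CW}_2,\mathcal{CW}_3,\dots$ in this order. It is a known fact that in each $\mathcal{CW}_n$, and also in $\mathcal{CW}_\infty$, the denominator of each fraction equals the numerator of the succeeding fraction (when there is one); hence these sequences can be written in the forms used in the claim. *)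

(* Defs.v *)
From mathcomp Require Import all_boot.

Set Implicit Arguments.
Unset Strict Implicit.
Unset Printing Implicit Defensive.

(* A fraction is an unreduced pair (numerator, denominator). *)
Definition fraction := (nat * nat)%type.

Definition CW_children (x : fraction) : seq fraction :=
  [:: (x.1, x.1 + x.2); (x.1 + x.2, x.2)].

(* The sequences are indexed from n = 1; CW 0 is a junk value. *)
Fixpoint CW (n : nat) : seq fraction :=
  match n with
  | 0 => [::]
  | 1 => [:: (1, 1)]
  | m.+1 => flatten [seq CW_children x | x <- CW m]
  end.

Definition CW_upto (m : nat) : seq fraction :=
  flatten [seq CW n | n <- iota 1 m].

(* Terms are numbered from 0. Every CW n with n >= 1 is nonempty, so the first
   i.+1 blocks always contain the term of index i; see CW_infE. *)
Definition CW_inf (i : nat) : fraction := nth (0, 0) (CW_upto i.+1) i.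

(* logn 2 i is the largest v such that 2 ^ v divides i, for i >= 1. *)
Definition kcoef (i : nat) : nat := 2 * logn 2 i + 1.

(* The facts below show that CW_inf does not depend on the number of blocks
   concatenated, and that the sequences can be written in linked form. *)

Lemma CWSS n : CW n.+2 = flatten [seq CW_children x | x <- CW n.+1].
Proof. by []. Qed.

Lemma size_CW n : size (CW n.+1) = 2 ^ n.
Proof.
elim: n => // n IHn; rewrite CWSS expnS -IHn.
by elim: (CW n.+1) => //= x s ->; rewrite mulnS.
Qed.

Lemma CW_uptoS m : CW_upto m.+1 = CW_upto m ++ CW m.+1.
Proof. by rewrite /CW_upto -[in LHS](addn1 m) iotaD map_cat flatten_cat /= cats0. Qed.

Lemma size_CW_upto m : m <= size (CW_upto m).
Proof.
elim: m => // m IHm; rewrite CW_uptoS size_cat size_CW -[m.+1]addn1.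
by rewrite leq_add // expn_gt0.
Qed.

Lemma nth_CW_upto m p i : i < size (CW_upto m) ->
  nth (0, 0) (CW_upto (m + p)) i = nth (0, 0) (CW_upto m) i.
Proof.
move=> lt_i; elim: p => [|p <-]; first by rewrite addn0.
rewrite addnS CW_uptoS nth_cat ifT //; elim: p => [|p IHp]; first by rewrite addn0.
by rewrite addnS CW_uptoS size_cat ltn_addr.
Qed.

Lemma CW_infE m i : i < size (CW_upto m) ->
  CW_inf i = nth (0, 0) (CW_upto m) i.
Proof.
move=> lt_i; rewrite -(nth_CW_upto i.+1 lt_i) addnC /CW_inf nth_CW_upto //.
exact: size_CW_upto.
Qed.

Definition CW_link : rel fraction := fun x y => x.2 == y.1.

Lemma CW_ends n : exists s,
  CW n.+1 = (1, n.+1) :: s /\ last (1, n.+1) s = (n.+1, 1).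
Proof.
elim: n => [|n [s [Es Ls]]]; first by exists [::].
rewrite CWSS Es; exists ((1 + n.+1, n.+1) :: flatten (map CW_children s)).
split=> //=; case/lastP: s {Es} Ls => [|s y] /=; first by case=> <-.
rewrite last_rcons map_rcons flatten_rcons last_cat /= => ->.
by rewrite addn1.
Qed.

Lemma CW_linked n : sorted CW_link (CW n).
Proof.
case: n => //; elim=> // n IHn; rewrite CWSS.
case: (CW n.+1) IHn => //= x s path_s.
apply/andP; split; first exact: eqxx.
elim: s x path_s => //= y s IHs x /andP[xy /IHs ->].
by rewrite andbT; apply/andP; split; [exact: xy | exact: eqxx].
Qed.

Lemma CW_upto_linked m : sorted CW_link (CW_upto m).
Proof.
suff: sorted CW_link (CW_upto m.+1) /\ last (1, 1) (CW_upto m.+1) = (m.+1, 1).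
  by rewrite CW_uptoS => -[/cat_sorted2[]].
elim: m => [|m [IHm Lm]] //.
rewrite CW_uptoS; have [s [Es Ls]] := CW_ends m.+1.
have := CW_linked m.+2; rewrite Es last_cat Lm => Hs; split; last exact: Ls.
case: (CW_upto m.+1) IHm Lm => //= x t Ht Lt.
by rewrite cat_path Ht /= Lt; apply/andP; split; [exact: eqxx | exact: Hs].
Qed.

Lemma CW_inf_linked i : (CW_inf i).2 = (CW_inf i.+1).1.
Proof.
rewrite (@CW_infE i.+2 i) /CW_inf; last exact: leq_trans (size_CW_upto _).
have /(sortedP (0, 0)) H := CW_upto_linked i.+2.
by apply/eqP; apply: H; apply: size_CW_upto.
Qed.

(* Main.v *)
(* Prepending 0/1 to the infinite sequence makes it invariant under replacing
   each fraction by its two children, since the children of 0/1 are 0/1 and 1/1.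
   The relation p + r = k_i q for the fractions p/q, q/r at positions i - 1 and i
   (counted from 0) is preserved by this replacement: for odd i the two fractions
   are the children p/(p+q), (p+q)/q of one parent and k_i = 1; for i = 2j they
   are (p+q)/q and q/(q+r) with parents p/q, q/r at positions j - 1 and j, and
   k_i = k_j + 2. *)

Require Import Defs.
From mathcomp Require Import all_boot all_order all_algebra.
From mathcomp Require Import zify.

Import GRing.Theory.

(** The relation is additive so that it stays in [nat], where subtraction truncates. *)
Definition kcoef_recurrent (s : seq fraction) := forall i, i.+1 < size s ->
  (nth (0, 0) s i).2 = (nth (0, 0) s i.+1).1 /\
  (nth (0, 0) s i).1 + (nth (0, 0) s i.+1).2 = kcoef i.+1 * (nth (0, 0) s i).2.

Definition CW_step (s : seq fraction) := flatten [seq CW_children x | x <- s].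

Lemma size_CW_step s : size (CW_step s) = (size s).*2.
Proof. by elim: s => //= x s; rewrite /CW_step /= => ->. Qed.

(* No bound on j: the children of the default (0, 0) are both (0, 0). *)
Lemma nth_CW_step s j (x := nth (0, 0) s j) :
  nth (0, 0) (CW_step s) j.*2 = (x.1, x.1 + x.2) /\
  nth (0, 0) (CW_step s) j.*2.+1 = (x.1 + x.2, x.2).
Proof.
by rewrite {}/x; elim: s j => [|y s IHs] [|j] //=; exact: IHs.
Qed.

Lemma kcoef_odd j : kcoef j.*2.+1 = 1.
Proof. by rewrite /kcoef lognE dvdn2 /= odd_double. Qed.

Lemma kcoef_double j : 0 < j -> kcoef j.*2 = kcoef j + 2.
Proof.
move=> j_gt0; have : logn 2 j.*2 = (logn 2 j).+1 by rewrite -mul2n lognM.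
by rewrite /kcoef; lia.
Qed.

Lemma kcoef_recurrent_step s : kcoef_recurrent s -> kcoef_recurrent (CW_step s).
Proof.
move=> rec_s i; rewrite size_CW_step -[i]odd_double_half.
case: (odd i) => /= lt_i; rewrite ?add1n ?add0n in lt_i *; last first.
  (* Even [i]: the coefficient has the odd index [i.+1], and the two fractions are siblings. *)
  by have [-> ->] := nth_CW_step s i./2; rewrite kcoef_odd mul1n.
have [_ ->] := nth_CW_step s i./2.
have /rec_s[linked rec_i] : i./2.+1 < size s by lia.
rewrite -doubleS; have [-> _] := nth_CW_step s i./2.+1.
by rewrite kcoef_double //= -linked; split=> //; lia.
Qed.

Lemma kcoef_recurrent_CW n : kcoef_recurrent (CW n.+1).
Proof. by elim: n => [|n IHn]; [case | exact: kcoef_recurrent_step]. Qed.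

Lemma CW_step_upto m :
  CW_step ((0, 1) :: CW_upto m) = (0, 1) :: CW_upto m.+1.
Proof.
elim: m => // m IHm; rewrite CW_uptoS [in RHS]CW_uptoS.
rewrite -(cat_cons _ (CW_upto m)) -(cat_cons _ (CW_upto m.+1)) -IHm.
by rewrite /CW_step map_cat flatten_cat.
Qed.

Lemma kcoef_recurrent_CW_upto m : kcoef_recurrent ((0, 1) :: CW_upto m).
Proof.
elim: m => [|m IHm]; first by case.
by rewrite -CW_step_upto; apply: kcoef_recurrent_step.
Qed.

(** Serves both halves of the theorem, with [c] equal to [a] or [b]: position 0 of [s] holds the
    initial values at -1 and 0. *)
Lemma kcoef_recurrent_int (s : seq fraction) (c : int -> nat) i :
    kcoef_recurrent s -> i.+1 < size s ->
    (forall j, j <= i.+1 -> nth (0, 0) s j = (c (j%:Z - 1), c j%:Z)%R) ->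
  ((c i.+1%:Z)%:Z
     = (kcoef i.+1)%:Z * (c (i.+1%:Z - 1))%:Z - (c (i.+1%:Z - 2))%:Z)%R.
Proof.
move=> rec_s lt_i cE; have [_] := rec_s i lt_i; rewrite !cE //=.
have -> : (i.+1%:Z - 1 = i%:Z)%R by lia.
have -> : (i.+1%:Z - 2 = i%:Z - 1)%R by lia.
by move=> eq_c; rewrite -PoszM -eq_c; lia.
Qed.

Local Open Scope ring_scope.

Theorem theorem2 :
  (forall a : int -> nat,
     a (-1) = 0%N ->
     (forall i : nat, (1 <= i)%N -> CW_inf i.-1 = (a (i%:Z - 1), a i%:Z)) ->
     a 0 = 1%N /\
     (forall i : nat, (1 <= i)%N ->
        (a i%:Z)%:Z = (kcoef i)%:Z * (a (i%:Z - 1))%:Z - (a (i%:Z - 2))%:Z))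
  /\
  (forall (n : nat) (b : int -> nat),
     (1 <= n)%N ->
     CW n = [seq (b (i%:Z - 1), b i%:Z) | i <- iota 0 (2 ^ (n - 1))%N] ->
     [/\ b (-1) = 1%N,
         b 0 = n
       & forall i : nat, (1 <= i < 2 ^ (n - 1))%N ->
           (b i%:Z)%:Z = (kcoef i)%:Z * (b (i%:Z - 1))%:Z - (b (i%:Z - 2))%:Z]).
Proof.
split=> [a aN1 aE | [//|n] b _].
  have a0 : a 0 = 1%N by have [<- _] := aE 1%N isT.
  split=> // -[//|i] _.
  apply: (kcoef_recurrent_int _ _ _ (kcoef_recurrent_CW_upto i.+1)).
    by rewrite ltnS size_CW_upto.
  (* Position 0 is the prepended 0/1, that is [a (-1)] over [a 0]; position [j.+1] is term [j] of
     [CW_inf]. *)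
  case=> [|j] le_j; first by rewrite /= a0 sub0r aN1.
  by rewrite -aE //= (@CW_infE i.+1) // (leq_trans le_j) ?size_CW_upto.
rewrite subn1 succnK => bE.
have nthE j : (j < 2 ^ n)%N -> nth (0, 0)%N (CW n.+1) j = (b (j%:Z - 1), b j%:Z).
  by move=> lt_j; rewrite bE (nth_map 0%N) ?size_iota // nth_iota.
(* The first fraction, 1 over [n.+1], gives both initial values. *)
have [s [Es _]] := CW_ends n.
have := nthE 0%N; rewrite expn_gt0 Es sub0r => /(_ isT) [<- <-].
split=> // -[//|i] lt_i.
apply: (kcoef_recurrent_int _ _ _ (kcoef_recurrent_CW n)); first by rewrite size_CW.
by move=> j le_j; apply: nthE; apply: leq_ltn_trans lt_i.
Qed.
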